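(* There are linear operators $B_{N}$ on the spaces $H_{N}$ ($N<\omega$) such that: (C1) there is a natural number $K_D$ such that for all $N<\omega$ and $v\in H_N$, $\|B_N(v)\|\le K_D\|v\|$; and (C2) if $B^{m}$ denotes the bounded operator on $H^{m}$ induced by the ultraproduct of the $B_N$, then $B^{m}\restriction H^{Im}=G^{m}B(G^{m})^{-1}$.
   Context: Inner products are linear in the second argument. $H$ is a (nonzero) separable complex Hilbert space and $A=qV$ with $q\in\mathbb{C}\setminus\{0\}$ and $V$ unitary on $H$; thus $A^{*}A=AA^{*}=r_{A}I$ with $r_A=|q|^2$. For $P\in\mathbb{C}[X,Y]$, $P(A,A^{*})$ is obtained by substituting $A$ for $X$ and $A^{*}$ for $Y$. $\phi\in H$ is a fixed unit vector that is cyclic: $\{P(A,A^{*})(\phi)\mid P\in\mathbb{C}[X,Y]\}$ is dense in $H$. For $N\in\omega$: $H_N$ is the span of $\{A^{i}(A^{*})^{j}\phi\mid i\le N,\ j\le N\}$, $H_N^{-}$ the span of those with $i<N,\ j\le N$, $H_N^{+}$ the span of those with $0<i\le N,\ j\le N$; $W^{\pm}$ are the orthogonal complements of $H_N^{\pm}$ in $H_N$ (of equal dimension). Fix a unitary $U_N:W^{-}\to W^{+}$ and let $A_N$ be the linear operator on $H_N$ with $A_N(u)=A(u)$ for $u\in H_N^{-}$ and $A_N(u)=\sqrt{r_A}\,U_N(u)$ for $u\in W^{-}$; $A_N$ is normal. $D_N=\dim H_N$ and $u_N(n)$, $n<D_N$, is an orthonormal basis of eigenvectors of $A_N$ with eigenvalues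 $\lambda_N(n)$, chosen so that $\xi_N(n)=\langle u_N(n)|\phi\rangle$ is a non-negative real. $M$ is a natural number strictly greater than $\|A\|$ and $\sqrt{r_A}$, $S=\{\lambda\in\mathbb{C}\mid |\mathrm{Re}\,\lambda|\le M,\ |\mathrm{Im}\,\lambda|\le M\}$. $\sigma(A)$ is the spectrum of $A$. $\mathcal{U}$ is an ultrafilter on $\omega$ such that for all $m\ge1$, $\{N\ge1\mid\sqrt N\in\omega,\ m\text{ divides }\sqrt N\}\in\mathcal{U}$. $H^{u}=\prod_NH_N/\mathcal{U}$; $\|\cdot\|_2^u$, $\langle\cdot|\cdot\rangle^u$ are the ultraproducts of the norms and inner products; $u\sim v$ iff $\|u-v\|_2^u$ is infinitesimal; $H^m$ is the Hilbert space of classes $v/\sim$ with $\|v\|_2^u$ bounded by a natural number, where $\langle u|v\rangle$ is the complex number infinitely close to $\langle u|v\rangle^u$. $G^m:H\to H^m$ is the isometric embedding given by $G^m(P(A,A^* )\phi)=(P(A,A^* )\phi)_{N<\omega}/\mathcal{U}/\sim$ and continuity, and $H^{Im}$ is its range. Measure: for $X\subseteq\mathbb{C}$, $\mu_N(X)=\sum\{\xi_N(n)^2\mid n<D_N,\ \lambda_N(n)\in X\}$ and $\mu^{\mathrm n}(X)=\lim_{\mathcal U}\mu_N(X)$. A real $r\in[-M,M]$ is nice if for all $\delta>0$ there is $\varepsilon>0$ with $\mu^{\mathrm n}(\{\lambda\in S\mid|\mathrm{Re}\,\lambda-r|<\varepsilon\})<\delta$ and $\mu^{\mathrm n}(\{\lambda\in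 S\mid|\mathrm{Im}\,\lambda-r|<\varepsilon\})<\delta$. $NI$ is a fixed countable dense subset of $[-M,M]$ of nice reals with $\pm M\in NI$. $Sq^*$ is the family of sets $\{\lambda\in S\mid r_0<\mathrm{Re}\,\lambda<r_1,\ r_2<\mathrm{Im}\,\lambda<r_3\}$, $r_0,\dots,r_3\in NI$. For $Y\subseteq\mathrm{Int}(S)$, $\mu^*(Y)=\inf\{\sum_{i}\mu^{\mathrm n}(X_i)\mid X_i\in Sq^*,\ Y\subseteq\bigcup_{i<\omega}X_i\}$; for $Y\subseteq\mathbb C$, $\mu^*(Y)=\mu^*(Y\cap\mathrm{Int}(S))$; $\mu$ is the restriction of $\mu^*$ to the Carathéodory measurable sets, a Borel probability measure on $S$ with $\mu(S\setminus\sigma(A))=0$. For $P\in\mathbb C[X,Y]$ let $f_P(\lambda)=P(\lambda,\overline\lambda)$. $G:L_2(S,\mu)\to H$ is the isometric isomorphism determined by $G(f_P)=P(A,A^* )(\phi)$; $L_2(S,\mu)$ is identified with $L_2(\sigma(A),\mu\restriction\sigma(A))$ by restriction. $B$ is a bounded linear operator on $H$ that has a continuous kernel: with $B_D=G^{-1}BG$, there is a continuous $K:\sigma(A)^2\to\mathbb C$ such that for all $P\in\mathbb C[X,Y]$, the function $y\mapsto\int_{\sigma(A)}K(x,y)f_P(x)\,d\mu(x)$, $y\in\sigma(A)$, is a (continuous) representative of $B_D(f_P)$. *)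

(* Defs.v *)
From HB Require Import structures.
From mathcomp Require Import all_boot all_order all_algebra.
From mathcomp Require Import all_classical all_reals all_analysis.
From mathcomp Require Import complex ring_quotient generic_quotient.

Set Implicit Arguments.
Unset Strict Implicit.
Unset Printing Implicit Defensive.

Import Order.TTheory GRing.Theory Num.Theory.
Import numFieldNormedType.Exports.

Local Open Scope classical_set_scope.
Local Open Scope ring_scope.
Local Open Scope quotient_scope.

HB.instance Definition _ (R : realType) := NormedModule.copy R[i] (R[i]^o).

Section hilbert.
Context {R : realType} {H : completeNormedModType R[i]}.
Variable dot : {dot H for (@Num.conj R[i])}.
Local Notation C := R[i].

(* {dot H for Num.conj} is linear in its first argument; [inner] is linear in
   the second one. *)
Definition inner (u v : H) : C := dot v u.

Definition hilbert_norm := forall v : H, `|v| ^+ 2 = inner v v.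

Definition separable_space := exists2 X : set H, countable X & dense X.

Definition unitary (V : H -> H) :=
  (forall u v, inner (V u) (V v) = inner u v) /\ (forall v, exists u, V u = v).

Definition is_adjoint (T T' : H -> H) :=
  forall u v, inner (T' u) v = inner u (T v).

Definition bounded_op (T : H -> H) :=
  exists K : nat, forall v, `|T v| <= K%:R * `|v|.

Definition opnorm (T : H -> H) : R :=
  sup [set complex.Re `|T v| | v in [set v | `|v| <= 1]].

Definition spectrum (T : H -> H) : set C :=
  [set l | ~ exists S : {linear H -> H},
     [/\ bounded_op S, forall v, S (T v - l *: v) = v &
         forall v, T (S v) - l *: S v = v]].

Definition lspan (X : set H) : {pred H} := fun v =>
  `[< exists n (c : 'I_n -> C) (x : 'I_n -> H),
        (forall i, X (x i)) /\ v = \sum_(i < n) c i *: x i >].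

Definition ortho_compl (X Y : set H) : set H :=
  [set w | X w /\ forall v, Y v -> inner v w = 0].

(* [T] only matters on [X] *)
Definition unitary_between (X Y : set H) (T : H -> H) :=
  [/\ forall (a : C) u v, X u -> X v -> T (a *: u + v) = a *: T u + T v,
      forall u v, X u -> X v -> inner (T u) (T v) = inner u v &
      T @` X = Y].

End hilbert.
Arguments separable_space {R} H.

Section span.
Context {R : realType} {H : completeNormedModType R[i]}.
Local Notation C := R[i].
Variable X : set H.

Fact lspan_submod_closed : submod_closed (lspan X).
Proof.
split.
  by apply/asboolP; exists 0%N, (fun=> 0), (fun=> 0); split => [[]//|];
    rewrite big_ord0.
move=> a _ _ /asboolP[m [c [x [Xx ->]]]] /asboolP[n [d [y [Xy ->]]]].
apply/asboolP; exists (m + n)%N.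
exists (fun i => match fintype.split i with inl j => a * c j | inr j => d j end).
exists (fun i => match fintype.split i with inl j => x j | inr j => y j end).
split=> [i|]; first by case: fintype.splitP.
rewrite big_split_ord scaler_sumr; congr (_ + _); apply: eq_bigr => i _.
  by case: fintype.splitP => [j /= /val_inj ->|k /= E]; [rewrite scalerA|
    move: (ltn_ord i); rewrite E ltnNge leq_addr].
case: fintype.splitP => [j /= E|k /= /eqP]; last by rewrite eqn_add2l => /eqP/val_inj ->.
by move: (ltn_ord j); rewrite -E ltnNge leq_addr.
Qed.

HB.instance Definition _ :=
  GRing.isSubmodClosed.Build C H (lspan X) lspan_submod_closed.

Record subspan := SubSpan { subspan_val : H ; _ : subspan_val \in lspan X }.

HB.instance Definition _ := [isSub for subspan_val].
HB.instance Definition _ := [Choice of subspan by <:].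
HB.instance Definition _ := [SubChoice_isSubLmodule of subspan by <:].

End span.

Definition orthonormal_basis {R : realType} {H : completeNormedModType R[i]}
    (dot : {dot H for (@Num.conj R[i])}) (X : set H) (n : nat)
    (u : 'I_n -> subspan X) :=
  (forall i j, inner dot (val (u i)) (val (u j)) = (i == j)%:R) /\
  (forall v, exists c : 'I_n -> R[i], v = \sum_(i < n) c i *: u i).

Section krylov.
Context {R : realType} {H : completeNormedModType R[i]}.
Variable dot : {dot H for (@Num.conj R[i])}.
Variables (A A' : H -> H) (phi : H).
Local Notation C := R[i].

Definition mono (i j : nat) : H := iter i A (iter j A' phi).

Definition monos (N : nat) : set H :=
  [set v | exists i j, [/\ (i <= N)%N, (j <= N)%N & v = mono i j]].
Definition monosm (N : nat) : set H :=
  [set v | exists i j, [/\ (i < N)%N, (j <= N)%N & v = mono i j]].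
Definition monosp (N : nat) : set H :=
  [set v | exists i j, [/\ (0 < i <= N)%N, (j <= N)%N & v = mono i j]].

Definition HN (N : nat) := subspan (monos N).
HB.instance Definition _ N := GRing.SubLmodule.on (HN N).

Definition HNset N : set H := [set` lspan (monos N)].
Definition HNm N : set H := [set` lspan (monosm N)].
Definition HNp N : set H := [set` lspan (monosp N)].

Definition Wm N := ortho_compl dot (HNset N) (HNm N).
Definition Wp N := ortho_compl dot (HNset N) (HNp N).

(* In {poly {poly C}} the outer indeterminate is X and the inner one is Y. *)
Definition poly_op (P : {poly {poly C}}) : H :=
  \sum_(i < size P) \sum_(j < size P`_i) P`_i`_j *: mono i j.

Definition cyclic_vector := dense (range poly_op).

End krylov.

Definition poly_fun {R : realType} (P : {poly {poly R[i]}}) (l : R[i]) : R[i] :=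
  P.[l%:P].[Num.conj l].

Definition all_sets (T : Type) := T.
HB.instance Definition _ (T : pointedType) := Pointed.on (all_sets T).
HB.instance Definition _ (T : pointedType) :=
  @isMeasurable.Build default_measure_display (all_sets T)
    (@discrete_measurable T) (@discrete_measurable0 T)
    (@discrete_measurableC T) (@discrete_measurableU T).

Section cover_outer_measure.
Local Open Scope ereal_scope.
Context {R : realType} {T : pointedType}.
Variables (F : set (set T)) (m : set T -> R).

Definition cover_outer (Y : set T) : \bar R :=
  ereal_inf [set \sum_(i <oo) (m (X i))%:E | X in
    [set X : (set T)^nat | (forall i, F (X i)) /\ Y `<=` \bigcup_i X i]].

Hypotheses (F0 : F set0) (m0 : m set0 = 0%R) (m_ge0 : forall X, (0 <= m X)%R).

(* [cover_outer] is the library's [mu_ext] for the set function equal to [m] on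
   [F] and to +oo elsewhere, all sets being measurable. *)
Definition cover_weight (X : set (all_sets T)) : \bar R :=
  if `[< F X >] then (m X)%:E else +oo.

Fact cover_weight0 : cover_weight set0 = 0.
Proof. by rewrite /cover_weight asboolT// m0. Qed.

Fact cover_weight_ge0 X : 0 <= cover_weight X.
Proof. by rewrite /cover_weight; case: ifP => _; rewrite ?lee_fin. Qed.

Fact cover_outerE : cover_outer = mu_ext cover_weight.
Proof.
apply/funext => Y; apply/eqP; rewrite eq_le; apply/andP; split.
  apply: le_ereal_inf_tmp => _ [X [_ YX] <-].
  have [FX|] := pselect (forall i, F (X i)).
    apply: ereal_inf_lbound; exists X => //; apply: eq_eseriesr => i _.
    by rewrite /cover_weight asboolT.
  move=> /existsNP[i nFX]; rewrite (@eseries_pinfty _ _ predT i) ?leey//.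
    by move=> j _; rewrite -ltNye (lt_le_trans _ (cover_weight_ge0 _)).
  by rewrite /cover_weight asboolF.
apply: le_ereal_inf_tmp => _ [X [FX YX] <-].
apply: ereal_inf_lbound; exists X => //; apply: eq_eseriesr => i _.
by rewrite /cover_weight asboolT.
Qed.

Lemma cover_outer0 : cover_outer set0 = 0.
Proof. by rewrite cover_outerE; exact: (mu_ext0 cover_weight0 cover_weight_ge0). Qed.

Lemma cover_outer_ge0 Y : 0 <= cover_outer Y.
Proof. by rewrite cover_outerE; exact: (mu_ext_ge0 cover_weight_ge0). Qed.

Lemma le_cover_outer : {homo cover_outer : X Y / X `<=` Y >-> X <= Y}.
Proof.
by rewrite cover_outerE; move=> X Y; exact: (@le_mu_ext _ (all_sets T)). Qed.

Lemma cover_outer_sigma_subadditive : sigma_subadditive cover_outer.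
Proof.
by rewrite cover_outerE; exact: (mu_ext_sigma_subadditive cover_weight_ge0). Qed.

End cover_outer_measure.

Section spectral_measure.
Context {R : realType}.
Local Notation C := R[i].
Variables (U : pfilter_on nat) (M : nat).
Variables (D : nat -> nat) (lam : forall N, 'I_(D N) -> C)
  (xi : forall N, 'I_(D N) -> R).

Definition square : set C :=
  [set l | `|complex.Re l| <= M%:R /\ `|complex.Im l| <= M%:R].

Definition muN (N : nat) (X : set C) : R :=
  \sum_(n < D N | `[< X (lam n) >]) xi n ^+ 2.

Definition mun (X : set C) : R := lim ((fun N => muN N X) @ (U : set_system nat)).

Definition nice (r : R) := forall d, 0 < d -> exists2 e, 0 < e &
  mun [set l | square l /\ `|complex.Re l - r| < e] < d /\
  mun [set l | square l /\ `|complex.Im l - r| < e] < d.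

Record nice_family (NI : set R) : Prop := NiceFamily {
  nice_countable : countable NI ;
  nice_subset : NI `<=` `[- M%:R, M%:R] ;
  nice_dense : `[- M%:R, M%:R] `<=` closure NI ;
  nice_nice : NI `<=` nice ;
  nice_maxM : NI M%:R ;
  nice_minM : NI (- M%:R) }.

Definition Sqstar (NI : set R) : set (set C) :=
  [set X | exists r0 r1 r2 r3, [/\ NI r0, NI r1, NI r2, NI r3 &
    X = [set l | square l /\ r0 < complex.Re l < r1 /\ r2 < complex.Im l < r3]]].

Definition mustar (NI : set R) (Y : set C) : \bar R :=
  cover_outer (Sqstar NI) mun (Y `&` square^°).

Lemma mun_ge0 X : 0 <= mun X.
Proof.
have h N : 0 <= muN N X by apply: sumr_ge0 => n _; exact: sqr_ge0.
rewrite /mun; have [c|/dvgP ->//] := pselect (cvg ((fun N => muN N X) @ (U : set_system nat))).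
by apply: limr_ge => //; exact: nearW.
Qed.

Lemma mun0 : mun set0 = 0.
Proof.
apply: lim_near_cst => //; apply: nearW => N.
by rewrite /muN big_pred0// => n; rewrite asboolF.
Qed.

Lemma Sqstar0 NI : nice_family NI -> Sqstar NI set0.
Proof.
move=> h; do 4! exists M%:R; split; try exact: nice_maxM h.
by apply/seteqP; split => // l [_ [/andP[/lt_trans/[apply]]]]; rewrite ltxx.
Qed.

Section outer.
Variables (NI : set R) (hNI : nice_family NI).

Fact mustar0 : mustar NI set0 = 0%E.
Proof.
by rewrite /mustar set0I; apply: cover_outer0;
  [exact: Sqstar0|exact: mun0|exact: mun_ge0].
Qed.

Fact mustar_ge0 Y : (0 <= mustar NI Y)%E.
Proof. by apply: cover_outer_ge0; exact: mun_ge0. Qed.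

Fact le_mustar : {homo mustar NI : X Y / X `<=` Y >-> (X <= Y)%E}.
Proof.
move=> X Y XY; apply: le_cover_outer; first exact: mun_ge0.
by move=> l [/XY Yl Sl]; split.
Qed.

Fact mustar_sigma_subadditive : sigma_subadditive (mustar NI).
Proof.
move=> Y; rewrite /mustar setI_bigcupl.
by apply: cover_outer_sigma_subadditive; exact: mun_ge0.
Qed.

(* As a set function on [caratheodory_type mu_outer], this is canonically a
   measure. *)
Definition mu_outer : {outer_measure set C -> \bar R} :=
  HB.pack (mustar NI) (isOuterMeasure.Build R C (mustar NI) mustar0 mustar_ge0
    le_mustar mustar_sigma_subadditive).

End outer.
End spectral_measure.

Section complex_L2.
Context {R : realType}.
Local Notation C := R[i].
Variable mu : {outer_measure set C -> \bar R}.
Local Notation CT := (caratheodory_type mu).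
Local Notation mum := (mu : {measure set CT -> \bar R}).

Definition cintegral (S : set C) (f : C -> C) : C :=
  (Rintegral mum S (fun x => complex.Re (f x))
   +i* Rintegral mum S (fun x => complex.Im (f x)))%C.

Definition sqmod (z : C) : R := complex.Re z ^+ 2 + complex.Im z ^+ 2.

(* Square-integrable functions, before identification of those that are
   almost everywhere equal. *)
Definition L2 (S : set C) (f : C -> C) :=
  [/\ measurable_fun (S : set CT) (fun x : CT => complex.Re (f x)),
      measurable_fun (S : set CT) (fun x : CT => complex.Im (f x)) &
      mum.-integrable S (fun x => (sqmod (f x))%:E)].

(* By the second condition [G f] only depends on the class of [f] modulo
   almost everywhere equality on [S]. *)
Definition L2_isometric_iso {H : completeNormedModType C} (S : set C)
    (G : (C -> C) -> H) :=
  [/\ forall (a : C) f g, L2 S f -> L2 S g ->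
        G (fun x => a * f x + g x) = a *: G f + G g,
      forall f, L2 S f ->
        `|G f| ^+ 2 = (Rintegral mum S (fun x => sqmod (f x)))%:C%C &
      forall v, exists2 f, L2 S f & G f = v].

Definition continuous_kernel {H : completeNormedModType C} (S sigma : set C)
    (G : (C -> C) -> H) (B : H -> H) := exists K : C -> C -> C,
  {within sigma `*` sigma, continuous (fun xy : C * C => K xy.1 xy.2)} /\
  forall P : {poly {poly C}}, exists g, [/\ L2 S g,
    forall y, sigma y -> g y = cintegral sigma (fun x => K x y * poly_fun P x) &
    G g = B (G (poly_fun P))].

End complex_L2.

Definition square_divisible (U : set_system nat) :=
  forall m, (1 <= m)%N ->
    U [set N | (1 <= N)%N /\ exists k, N = (k ^ 2)%N /\ (m %| k)%N].

Section ultraproduct.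
Context {R : realType} {H : completeNormedModType R[i]}.
Variable dot : {dot H for (@Num.conj R[i])}.
Variables (A A' : H -> H) (phi : H) (U : pfilter_on nat).
Local Notation C := R[i].
Local Notation HN := (HN A A' phi).

Definition prodHN := forall N, HN N.

HB.instance Definition _ := gen_eqMixin prodHN.
HB.instance Definition _ := gen_choiceMixin prodHN.

Definition prod_add (u v : prodHN) : prodHN := fun N => u N + v N.
Definition prod_opp (u : prodHN) : prodHN := fun N => - u N.
Definition prod_zero : prodHN := fun N => 0.
Definition prod_scale (a : C) (u : prodHN) : prodHN := fun N => a *: u N.

Fact prod_addA : associative prod_add.
Proof. by move=> u v w; apply: functional_extensionality_dep => N; exact: addrA. Qed.
Fact prod_addC : commutative prod_add.
Proof. by move=> u v; apply: functional_extensionality_dep => N; exact: addrC. Qed.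
Fact prod_add0 : left_id prod_zero prod_add.
Proof. by move=> u; apply: functional_extensionality_dep => N; exact: add0r. Qed.
Fact prod_addN : left_inverse prod_zero prod_opp prod_add.
Proof. by move=> u; apply: functional_extensionality_dep => N; exact: addNr. Qed.

HB.instance Definition _ :=
  GRing.isZmodule.Build prodHN prod_addA prod_addC prod_add0 prod_addN.

Fact prod_scaleA (a b : C) v :
  prod_scale a (prod_scale b v) = prod_scale (a * b) v.
Proof. by apply: functional_extensionality_dep => N; exact: scalerA. Qed.
Fact prod_scale1 : left_id 1 prod_scale.
Proof. by move=> v; apply: functional_extensionality_dep => N; exact: scale1r. Qed.
Fact prod_scaleDr : right_distributive prod_scale +%R.
Proof. by move=> a u v; apply: functional_extensionality_dep => N; exact: scalerDr. Qed.
Fact prod_scaleDl v : {morph prod_scale^~ v : a b / a + b}.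
Proof. by move=> a b; apply: functional_extensionality_dep => N; exact: scalerDl. Qed.

HB.instance Definition _ := GRing.Zmodule_isLmodule.Build C prodHN
  prod_scaleA prod_scale1 prod_scaleDr prod_scaleDl.

Definition ufinite : {pred prodHN} := fun v =>
  `[< exists K : nat, \forall N \near (U : set_system nat), `|val (v N)| <= K%:R >].

Fact ufinite_submod_closed : submod_closed ufinite.
Proof.
split.
  by apply/asboolP; exists 0%N; apply: nearW => N; rewrite raddf0 normr0.
move=> a u v /asboolP[k hk] /asboolP[l hl]; apply/asboolP.
pose n := Num.bound (complex.Re `|a|).
exists (n * k + l)%N; near=> N.
have -> : val ((a *: u + v) N) = a *: val (u N) + val (v N).
  by rewrite -linearZ -raddfD.
rewrite (le_trans (ler_normD _ _))// natrD.
rewrite lerD//; last by near: N.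
rewrite normrZ natrM ler_pM//; last by near: N.
have na : `|a| = (complex.Re `|a|)%:C%C by rewrite RRe_real// normr_real.
rewrite na -(rmorph_nat (real_complex R)) lecR ltW// archi_boundP//.
by have := normr_ge0 a; rewrite na ler0c.
Unshelve. all: by end_near. Qed.

HB.instance Definition _ :=
  GRing.isSubmodClosed.Build C prodHN ufinite ufinite_submod_closed.

Record finHN := FinHN { finHN_val : prodHN ; _ : finHN_val \in ufinite }.
HB.instance Definition _ := [isSub for finHN_val].
HB.instance Definition _ := [Choice of finHN by <:].
HB.instance Definition _ := [SubChoice_isSubLmodule of finHN by <:].

Definition infinitesimal : {pred finHN} := fun v =>
  `[< forall e : R, 0 < e ->
        \forall N \near (U : set_system nat), `|val (finHN_val v N)| < e%:C%C >].

Fact infinitesimal_submod_closed : submod_closed infinitesimal.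
Proof.
split.
  by apply/asboolP => e e0; apply: nearW => N;
    rewrite raddf0 normr0 -(rmorph0 (real_complex R)) ltcR.
move=> a u v /asboolP hu /asboolP hv; apply/asboolP => e e0.
have e20 : 0 < e / 2 by rewrite divr_gt0.
pose n := complex.Re `|a|.
have na : `|a| = n%:C%C by rewrite RRe_real// normr_real.
have n0 : 0 <= n.
  by have := normr_ge0 a; rewrite na ler0c.
have n1 : 0 < n + 1 by rewrite ltr_wpDl.
have /hu uN : 0 < (e / 2) / (n + 1) by rewrite divr_gt0.
near=> N.
have -> : val (finHN_val (a *: u + v) N) =
    a *: val (finHN_val u N) + val (finHN_val v N).
  by rewrite -linearZ -raddfD.
rewrite (le_lt_trans (ler_normD _ _))// (splitr e) rmorphD ltr_leD//; last first.
  by apply: ltW; near: N; exact: hv.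
rewrite normrZ na (@le_lt_trans _ _ (n%:C * ((e / 2) / (n + 1))%:C)%C)//.
  by apply: ler_wpM2l; [rewrite ler0c|apply: ltW; near: N].
rewrite -rmorphM ltcR mulrCA gtr_pMr// ltr_pdivrMr// mul1r ltrDl//.
Unshelve. all: by end_near. Qed.

HB.instance Definition _ :=
  GRing.isSubmodClosed.Build C finHN infinitesimal infinitesimal_submod_closed.

Definition Hm := Quotient.quot infinitesimal.
HB.instance Definition _ := GRing.Zmodule.on Hm.
HB.instance Definition _ := EqQuotient.on Hm.
HB.instance Definition _ := ZmodQuotient.on Hm.

Definition Hm_class (v : finHN) : Hm := \pi v.

Lemma Hm_classE (u v : finHN) :
  Hm_class u = Hm_class v <-> u - v \in infinitesimal.
Proof. by rewrite Quotient.idealrBE; split => [/eqP|/eqP]. Qed.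

Lemma Hm_class_repr x : Hm_class (repr x) = x.
Proof. exact: reprK. Qed.

Fact Hm_class_is_zmod_morphism : zmod_morphism Hm_class.
Proof. exact: (@pi_is_zmod_morphism _ _ _ Hm). Qed.
HB.instance Definition _ :=
  GRing.isZmodMorphism.Build finHN Hm Hm_class Hm_class_is_zmod_morphism.

Definition Hm_scale (a : C) (x : Hm) : Hm := Hm_class (a *: repr x).

Fact Hm_scaleE a v : Hm_scale a (Hm_class v) = Hm_class (a *: v).
Proof. by apply/Hm_classE; rewrite -scalerBr rpredZ//; apply/Hm_classE/reprK. Qed.

Fact Hm_scaleA (a b : C) x : Hm_scale a (Hm_scale b x) = Hm_scale (a * b) x.
Proof. by rewrite -[x]Hm_class_repr !Hm_scaleE scalerA. Qed.
Fact Hm_scale1 : left_id 1 Hm_scale.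
Proof. by move=> x; rewrite -[x]Hm_class_repr Hm_scaleE scale1r. Qed.
Fact Hm_scaleDr : right_distributive Hm_scale +%R.
Proof.
move=> a x y; rewrite -[x]Hm_class_repr -[y]Hm_class_repr -raddfD !Hm_scaleE.
by rewrite -raddfD scalerDr.
Qed.
Fact Hm_scaleDl x : {morph Hm_scale^~ x : a b / a + b}.
Proof.
by move=> a b; rewrite -[x]Hm_class_repr !Hm_scaleE -raddfD scalerDl.
Qed.

HB.instance Definition _ := GRing.Zmodule_isLmodule.Build C Hm
  Hm_scaleA Hm_scale1 Hm_scaleDr Hm_scaleDl.

Fact Hm_class_is_scalable : scalable Hm_class.
Proof. by move=> a v; rewrite -Hm_scaleE. Qed.
HB.instance Definition _ :=
  GRing.isScalable.Build C finHN Hm *:%R Hm_class Hm_class_is_scalable.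

(* The limit exists for an ultrafilter [U], both sequences being bounded. *)
Definition Hm_inner (x y : Hm) : C :=
  lim ((fun N => inner dot (val (finHN_val (repr x) N))
                           (val (finHN_val (repr y) N))) @ (U : set_system nat)).

Definition uniformly_bounded (BN : forall N, {linear HN N -> HN N}) :=
  exists K : nat, forall N (v : HN N), `|val (BN N v)| <= K%:R * `|val v|.

Definition ultra_embedding (G : H -> Hm) :=
  (forall v w, Hm_inner (G v) (G w) = inner dot v w) /\
  forall (P : {poly {poly C}}) (v : finHN),
    (\forall N \near (U : set_system nat),
      val (finHN_val v N) = poly_op A A' phi P) ->
    G (poly_op A A' phi P) = Hm_class v.

Section ultra_op.
Variables (BN : forall N, {linear HN N -> HN N}) (hBN : uniformly_bounded BN).

Definition prod_op (v : prodHN) : prodHN := fun N => BN N (v N).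

Fact prod_op_ufinite (v : finHN) : prod_op (val v) \in ufinite.
Proof.
have [K hK] := hBN; have /asboolP[k hk] := valP v.
apply/asboolP; exists (K * k)%N; near=> N.
rewrite (le_trans (hK _ _))// natrM ler_wpM2l//.
by near: N.
Unshelve. all: by end_near. Qed.

Definition fin_op (v : finHN) : finHN := FinHN (prod_op_ufinite v).

Definition ultra_op (x : Hm) : Hm := Hm_class (fin_op (repr x)).

Lemma ultra_opE v : ultra_op (Hm_class v) = Hm_class (fin_op v).
Proof.
apply/Hm_classE; have [K hK] := hBN.
have /Hm_classE/asboolP h : Hm_class (repr (Hm_class v)) = Hm_class v.
  exact: Hm_class_repr.
apply/asboolP => e e0.
have K0 : 0 < K%:R + 1 :> R by rewrite ltr_wpDl.
have /h hN : 0 < e / (K%:R + 1) by rewrite divr_gt0.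
set w := repr _ in h hN *; near=> N.
have -> : val (finHN_val (fin_op w - fin_op v) N) =
    val (BN N (finHN_val (w - v) N)).
  transitivity (val (BN N (finHN_val w N - finHN_val v N))) => //.
  by rewrite (raddfB (BN N)).
rewrite (le_lt_trans (hK _ _))//.
rewrite (@le_lt_trans _ _ (K%:R * (e / (K%:R + 1))%:C)%C)//.
  by apply: ler_wpM2l => //; apply: ltW; near: N; exact: hN.
rewrite -(rmorph_nat (real_complex R)) -rmorphM ltcR mulrCA gtr_pMr//.
by rewrite ltr_pdivrMr// mul1r ltrDl.
Unshelve. all: by end_near. Qed.

End ultra_op.
End ultraproduct.

(* Main.v *)
Require Import Defs.
From HB Require Import structures.
From mathcomp Require Import all_boot all_order all_algebra.
From mathcomp Require Import all_classical all_reals all_analysis.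
From mathcomp Require Import complex.

Set Implicit Arguments.
Unset Strict Implicit.
Unset Printing Implicit Defensive.

Import Order.TTheory GRing.Theory Num.Theory.
Import numFieldNormedType.Exports.

Local Open Scope classical_set_scope.
Local Open Scope ring_scope.

(** The operators can be taken to be the compressions of [B]: if [P_N] is the
orthogonal projection of [H] onto [H_N], let [B_N v = P_N (B v)].  They are
uniformly bounded because [P_N] is a contraction.

To compare the ultraproduct of the [B_N] with [B], one first observes that
[Gm w] is represented by the sequence of projections [(P_N w)_N], for every [w]
and not only for the polynomial vectors [poly_op A Aadj phi P] on which [Gm] is
prescribed ([Gm_proj_seq]).  Indeed [Gm] and the map sending [w] to the class of
[(P_N w)_N] are linear and do not increase norms, and they agree on the
polynomial vectors, which are dense since [phi] is cyclic and each of which lies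
in [H_N] for all large [N].
Consequently the two sides of the claimed equality at [v] are represented by
[P_N B P_N v] and [P_N B v], at distance at most [K |v - P_N v|], where [K] is
a bound of [B].  This tends to 0 along the ultrafilter, by density again and
because [P_N v] is the best approximation of [v] in [H_N]
([proj_residual_lt]). *)

(** * Orthogonal projection onto a span with a finite orthonormal basis *)

Section projection.
Context {R : realType} {H : completeNormedModType R[i]}.
Variable dot : {dot H for (@Num.conj R[i])}.
Hypothesis dot_norm : hilbert_norm dot.
Variables (X : set H) (n : nat) (u : 'I_n -> subspan X).
Hypothesis u_basis : orthonormal_basis dot u.

Definition proj (w : H) : subspan X :=
  \sum_(i < n) inner dot (val (u i)) w *: u i.

Lemma proj_is_linear : linear proj.
Proof.
move=> a v w; rewrite /proj scaler_sumr -big_split/=; apply: eq_bigr => i _.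
by rewrite /inner linearDl linearZl_LR scalerA -scalerDl.
Qed.

HB.instance Definition _ :=
  GRing.isLinear.Build R[i] H (subspan X) *:%R proj proj_is_linear.

Lemma proj_residual_basis i w :
  inner dot (val (u i)) (w - val (proj w)) = 0.
Proof.
rewrite /inner linearBl /proj raddf_sum/= linear_sumlz (bigD1 i)//=.
rewrite linearZl_LR /= [dot (val (u i)) _](u_basis.1 i i) eqxx mulr1.
rewrite big1 ?addr0 ?subrr// => j ji.
rewrite linearZl_LR /= [dot (val (u j)) _](u_basis.1 i j).
by rewrite eq_sym (negPf ji) mulr0.
Qed.

Lemma proj_residual_ortho (x : subspan X) w :
  inner dot (val x) (w - val (proj w)) = 0.
Proof.
have [c xE] := u_basis.2 x.
have -> : val x = \sum_(i < n) c i *: val (u i) by rewrite xE raddf_sum.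
rewrite /inner linear_sumr big1// => i _.
by rewrite linearZr_LR /= [dot _ _]proj_residual_basis mulr0.
Qed.

Lemma proj_pythagoras w :
  `|w| ^+ 2 = `|val (proj w)| ^+ 2 + `|w - val (proj w)| ^+ 2.
Proof.
rewrite !dot_norm /inner -{1 2}(subrKC (val (proj w)) w).
rewrite hnormDd// hermC /= [dot _ _]proj_residual_ortho.
by rewrite rmorph0 mulr0.
Qed.

Lemma proj_le w : `|val (proj w)| <= `|w|.
Proof.
by rewrite -(@ler_pXn2r _ 2) ?nnegrE// (proj_pythagoras w) lerDl exprn_ge0.
Qed.

Lemma proj_residual_le w : `|w - val (proj w)| <= `|w|.
Proof.
by rewrite -(@ler_pXn2r _ 2) ?nnegrE// (proj_pythagoras w) lerDr exprn_ge0.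
Qed.

Lemma proj_id (x : subspan X) : proj (val x) = x.
Proof.
apply/esym/eqP; rewrite -subr_eq0; apply/eqP/val_inj.
apply/normr0_eq0/eqP; rewrite -sqrf_eq0 dot_norm.
by rewrite [in X in inner _ _ X]raddfB proj_residual_ortho.
Qed.

(** The residual operator [1 - P] is a contraction that kills the subspace, so
    [w] may be replaced by [w - x] before taking its residual. *)
Lemma proj_best_approx w (x : subspan X) :
  `|w - val (proj w)| <= `|w - val x|.
Proof.
have := proj_residual_le (w - val x); rewrite raddfB /= proj_id.
by rewrite raddfB/= opprK addrACA addNr addr0.
Qed.

End projection.

(** * Polynomial vectors and the filter *)

Section krylov_spaces.
Context {R : realType} {H : completeNormedModType R[i]}.
Variables (A Aadj : H -> H) (phi : H).

(** Once [N] exceeds the degrees in both indeterminates, every monomial of [P]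
    is one of the generators of [H_N]. *)
Lemma poly_op_in_lspan (P : {poly {poly R[i]}}) :
  exists n, forall N, (n <= N)%N ->
    poly_op A Aadj phi P \in lspan (monos A Aadj phi N).
Proof.
exists (maxn (size P) (\max_(i < size P) size (P`_i)%R)) => N.
rewrite geq_max => /andP[sP /bigmax_leqP sPi].
apply: rpred_sum => i _; apply: rpred_sum => j _; apply: rpredZ.
apply/asboolP; exists 1%N, (fun=> 1), (fun=> mono A Aadj phi i j); split.
  move=> _; exists i, j; split=> //.
    exact: leq_trans (ltnW (ltn_ord i)) sP.
  exact: leq_trans (ltnW (ltn_ord j)) (sPi i isT).
by rewrite big_ord_recl big_ord0 scale1r addr0.
Qed.

End krylov_spaces.

(** A positive square [k ^ 2] with [k] divisible by [n.+1] is larger than [n]: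
    this is how the divisibility condition makes the filter contain all the
    cofinite sets. *)
Lemma square_divisible_large (U : pfilter_on nat) :
  square_divisible (U : set_system nat) ->
  forall n, \forall N \near (U : set_system nat), (n <= N)%N.
Proof.
move=> U_square n; apply: filterS (U_square n.+1 isT) => N [N0 [k [Nk nk]]].
move: N0; rewrite Nk expn_gt0 orbF => k0.
have n_lt_k := dvdn_leq k0 nk.
by rewrite (leq_trans (ltnW n_lt_k))// -mulnn leq_pmulr.
Qed.

(** A value of [lim] other than the default one, 0, forces convergence: this
    is how the inner product of the ultraproduct, a value of [lim], bounds the
    representing sequences along the filter. *)
Lemma near_lt_of_lim {R : realType} (U : pfilter_on nat) (f : nat -> R[i])
    (z e : R[i]) : (forall N, 0 <= f N) ->
  lim (f @ (U : set_system nat)) = z -> 0 < z -> z < e ->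
  \forall N \near (U : set_system nat), f N < e.
Proof.
move=> f0 fz z0 ze.
have fcvg : f @ (U : set_system nat) --> z.
  rewrite -fz; apply: contrapT => /dvgP fdvg.
  by move: fz z0; rewrite fdvg => <-; rewrite ltxx.
have ze0 : 0 < e - z by rewrite subr_gt0.
move: fcvg => /cvgrPdist_lt/(_ _ ze0); apply: filterS => N.
rewrite distrC => fN; rewrite -(ltrD2r (- z)).
apply: le_lt_trans fN; apply: real_ler_norm.
by rewrite rpredB// realE ?f0// ltW.
Qed.

(** * The embedding by sequences of projections *)

Section ultraproduct.
Context {R : realType} {H : completeNormedModType R[i]}.
Variable dot : {dot H for (@Num.conj R[i])}.
Hypothesis dot_norm : hilbert_norm dot.
Variables (A Aadj : H -> H) (phi : H) (U : pfilter_on nat).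
Local Notation finHN := (finHN A Aadj phi U).
Local Notation Hm := (Hm A Aadj phi U).

Lemma finHN_valB (v w : finHN) N :
  val (finHN_val (v - w) N) = val (finHN_val v N) - val (finHN_val w N).
Proof.
by transitivity (val (finHN_val v N - finHN_val w N)); rewrite // raddfB.
Qed.

(** A vector of the ultraproduct vanishes if it has arbitrarily small
    representatives; the representative may depend on the required precision,
    which suits density arguments. *)
Lemma Hm_class_eq0 (v : finHN) :
  (forall e : R, 0 < e -> exists2 w, Hm_class w = Hm_class v &
     \forall N \near (U : set_system nat),
       `|val (finHN_val w N)| <= e%:C%C) ->
  Hm_class v = 0.
Proof.
move=> small; rewrite -(raddf0 (@Hm_class _ _ A Aadj phi U)).
apply/Hm_classE; rewrite subr0; apply/asboolP => e e0.
have e20 : 0 < e / 2 by rewrite divr_gt0.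
have [w /esym/Hm_classE/asboolP vw wle] := small _ e20.
near=> N.
rewrite -(subrK (val (finHN_val w N)) (val (finHN_val v N))) -finHN_valB.
rewrite (le_lt_trans (ler_normD _ _))// (splitr e) rmorphD ltr_leD//.
  by near: N; exact: vw.
by near: N.
Unshelve. all: by end_near. Qed.

Variable Gm : {linear H -> Hm}.
Hypothesis Gm_embedding : ultra_embedding dot Gm.

(** The case [w = 0] is apart: the norm of [Gm w] is then 0, and a limit equal
    to the default value says nothing about the sequence. *)
Lemma Gm_repr_lt w (e : R) : `|w| < e%:C%C ->
  \forall N \near (U : set_system nat),
    `|val (finHN_val (repr (Gm w)) N)| < e%:C%C.
Proof.
move=> we; have e0 : 0 < e by rewrite -ltcR rmorph0 (le_lt_trans _ we).
have [->|w0] := eqVneq w 0.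
  have : repr (Gm 0) - 0 \in @infinitesimal _ _ A Aadj phi U.
    by apply/Hm_classE; rewrite Hm_class_repr !raddf0.
  by rewrite subr0 => /asboolP/(_ _ e0).
have we2 : `|w| ^+ 2 < e%:C%C ^+ 2.
  by rewrite ltr_pXn2r ?nnegrE// ler0c ltW.
have w20 : 0 < `|w| ^+ 2 by rewrite exprn_gt0// normr_gt0.
have := Gm_embedding.1 w w; rewrite -dot_norm => /near_lt_of_lim.
move=> /(_ (e%:C%C ^+ 2)) near_w; apply: filterS (near_w _ w20 we2) => N.
  by rewrite -dot_norm ltr_pXn2r ?nnegrE// ler0c ltW.
by rewrite -dot_norm exprn_ge0.
Qed.

Hypothesis U_large : forall n, \forall N \near (U : set_system nat), (n <= N)%N.
Hypothesis phi_cyclic : cyclic_vector A Aadj phi.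

Lemma poly_op_approx w (e : R) : 0 < e ->
  exists P, `|w - poly_op A Aadj phi P| < e%:C%C.
Proof.
move=> e0.
have e0' : 0 < e%:C%C :> R[i] by rewrite -(rmorph0 (real_complex R)) ltcR.
have [||v [wv [P _ Pv]]] := phi_cyclic (O := (ball w e%:C%C)°).
- by exists w; apply: nbhs_singleton; apply: nbhs_interior; exact: nbhsx_ballx.
- exact: open_interior.
by exists P; rewrite Pv; move/interior_subset: wv; rewrite -ball_normE.
Qed.

Variables (D : nat -> nat) (u : forall N, 'I_(D N) -> HN A Aadj phi N).
Hypothesis u_basis : forall N, orthonormal_basis dot (@u N).

Lemma proj_residual_lt w (e : R) : 0 < e ->
  \forall N \near (U : set_system nat), `|w - val (proj dot (@u N) w)| < e%:C%C.
Proof.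
move=> /(poly_op_approx w)[P wP]; have [n Pn] := poly_op_in_lspan A Aadj phi P.
apply: filterS (U_large n) => N /Pn PN.
apply: le_lt_trans wP.
exact: (proj_best_approx dot_norm (u_basis N) w (SubSpan PN)).
Qed.

Lemma proj_ufinite w :
  (fun N => proj dot (@u N) w) \in @ufinite _ _ A Aadj phi U.
Proof.
apply/asboolP; exists (Num.bound (complex.Re `|w|)); apply: nearW => N.
apply: (le_trans (proj_le dot_norm (u_basis N) w)).
have wE : `|w| = (complex.Re `|w|)%:C%C by rewrite RRe_real// normr_real.
rewrite wE -(rmorph_nat (real_complex R)) lecR ltW// archi_boundP//.
by have := normr_ge0 w; rewrite wE ler0c.
Qed.

Definition proj_seq w : finHN := FinHN (proj_ufinite w).

Lemma proj_seqB v w : proj_seq (v - w) = proj_seq v - proj_seq w.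
Proof.
by apply/val_inj/functional_extensionality_dep => N; exact: raddfB.
Qed.

Lemma Gm_poly_op P :
  Gm (poly_op A Aadj phi P) = Hm_class (proj_seq (poly_op A Aadj phi P)).
Proof.
apply: Gm_embedding.2; have [n Pn] := poly_op_in_lspan A Aadj phi P.
apply: filterS (U_large n) => N /Pn PN.
by rewrite /= -[X in proj _ _ X]/(val (SubSpan PN)) proj_id.
Qed.

(** The difference of the two sides is unchanged when [w] is replaced by
    [w - p], where [p] is a polynomial vector; choosing [p] close to [w], it is
    represented by a sequence of small vectors. *)
Lemma Gm_proj_seq w : Gm w = Hm_class (proj_seq w).
Proof.
apply/eqP; rewrite -subr_eq0; apply/eqP.
rewrite -[Gm w]Hm_class_repr -raddfB; apply: Hm_class_eq0 => e e0.
have e20 : 0 < e / 2 by rewrite divr_gt0.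
have [P wP] := poly_op_approx w e20; set p := poly_op _ _ _ _ in wP.
exists (repr (Gm (w - p)) - proj_seq (w - p)).
  rewrite proj_seqB !raddfB/= !Hm_class_repr /p -Gm_poly_op.
  by rewrite opprK addrACA addNr addr0.
near=> N.
rewrite finHN_valB (le_trans (ler_normB _ _))// (splitr e) rmorphD lerD//.
  by apply: ltW; near: N; exact: Gm_repr_lt.
exact: le_trans (proj_le dot_norm (u_basis N) _) (ltW wP).
Unshelve. all: by end_near. Qed.

(** * Compressions of a bounded operator *)

Variable B : {linear H -> H}.
Hypothesis B_bounded : bounded_op B.

Definition compression N : HN A Aadj phi N -> HN A Aadj phi N :=
  fun v => proj dot (@u N) (B (val v)).

Lemma compression_is_linear N : linear (@compression N).
Proof. by move=> a v w; rewrite /compression !linearP. Qed.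

HB.instance Definition _ N := GRing.isLinear.Build R[i] (HN A Aadj phi N)
  (HN A Aadj phi N) *:%R (@compression N) (@compression_is_linear N).

Lemma compression_bounded :
  uniformly_bounded (fun N => @compression N : {linear _ -> _}).
Proof.
have [K BK] := B_bounded; exists K => N v.
exact: le_trans (proj_le dot_norm (u_basis N) _) (BK _).
Qed.

(** The two sides are represented by [P_N B P_N v] and [P_N B v], so that their
    difference is the image of the residual [v - P_N v] by the uniformly bounded
    operators [P_N B]. *)
Lemma ultra_op_compression v :
  ultra_op compression_bounded (Gm v) = Gm (B v).
Proof.
rewrite !Gm_proj_seq ultra_opE; apply/eqP; rewrite -subr_eq0 -raddfB.
apply/eqP/Hm_class_eq0 => e e0.
set w := (X in Hm_class X); exists w => //; rewrite {}/w.
have [K BK] := B_bounded.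
(* K may vanish, hence the division by K + 1. *)
have K0 : 0 < K%:R + 1 :> R by rewrite ltr_wpDl.
have eK0 : 0 < e / (K%:R + 1) by rewrite divr_gt0.
have := proj_residual_lt v eK0; apply: filterS => N /ltW.
rewrite finHN_valB distrC => vN.
rewrite [X in `|X|](_ : _ =
    val (proj dot (@u N) (B (val (proj dot (@u N) v) - v)))); last first.
  by rewrite !raddfB.
apply: le_trans (proj_le dot_norm (u_basis N) _) _.
apply: le_trans (BK _) _.
apply: (@le_trans _ _ (K%:R * (e / (K%:R + 1))%:C%C)); first exact: ler_wpM2l.
rewrite -(rmorph_nat (real_complex R)) -rmorphM lecR mulrCA ger_pMr//.
by rewrite ler_pdivrMr// mul1r lerDl.
Qed.

End ultraproduct.

Theorem lemma5p1 (R : realType) (H : completeNormedModType R[i])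
    (dot : {dot H for (@Num.conj R[i])})
    (H_hilbert : hilbert_norm dot) (H_separable : separable_space H)
    (q : R[i]) (V A Aadj : {linear H -> H}) (phi : H)
    (q_neq0 : q != 0) (V_unitary : unitary dot V)
    (A_def : forall v, A v = q *: V v)
    (Aadj_adjoint : is_adjoint dot A Aadj)
    (phi_unit : `|phi| = 1)
    (phi_cyclic : cyclic_vector A Aadj phi)
    (UN : nat -> H -> H)
    (UN_unitary : forall N, unitary_between dot
       (Wm dot A Aadj phi N) (Wp dot A Aadj phi N) (UN N))
    (AN : forall N, {linear HN A Aadj phi N -> HN A Aadj phi N})
    (AN_HNm : forall N (v : HN A Aadj phi N),
       HNm A Aadj phi N (val v) -> val (AN N v) = A (val v))
    (AN_Wm : forall N (v : HN A Aadj phi N),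
       Wm dot A Aadj phi N (val v) ->
       val (AN N v) = (Num.sqrt (sqmod q))%:C%C *: UN N (val v))
    (D : nat -> nat) (u : forall N, 'I_(D N) -> HN A Aadj phi N)
    (lam : forall N, 'I_(D N) -> R[i]) (xi : forall N, 'I_(D N) -> R)
    (u_basis : forall N, orthonormal_basis dot (u N))
    (u_eigen : forall N n, AN N (u N n) = lam N n *: u N n)
    (xi_def : forall N n, inner dot (val (u N n)) phi = (xi N n)%:C%C)
    (xi_ge0 : forall N n, 0 <= xi N n)
    (M : nat) (M_gt_opnorm : opnorm A < M%:R)
    (M_gt_sqrt : Num.sqrt (sqmod q) < M%:R)
    (U : pfilter_on nat) (U_ultra : UltraFilter U)
    (U_square : square_divisible U)
    (NI : set R) (NI_nice : nice_family U M lam xi NI)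
    (mu := mu_outer NI_nice)
    (G : (R[i] -> R[i]) -> H)
    (G_iso : L2_isometric_iso mu (square M) G)
    (G_poly : forall P, G (poly_fun P) = poly_op A Aadj phi P)
    (Gm : {linear H -> Hm A Aadj phi U})
    (Gm_embedding : ultra_embedding dot Gm)
    (B : {linear H -> H}) (B_bounded : bounded_op B)
    (B_kernel : continuous_kernel mu (square M) (spectrum A) G B) :
  exists (BN : forall N, {linear HN A Aadj phi N -> HN A Aadj phi N})
         (C1 : uniformly_bounded BN),
    forall v : H, ultra_op C1 (Gm v) = Gm (B v).
Proof.
have U_large := square_divisible_large U_square.
exists (fun N => @compression _ _ dot A Aadj phi D u B N : {linear _ -> _}).
exists (compression_bounded H_hilbert u_basis B_bounded) => v.
exact: (ultra_op_compression H_hilbert Gm_embedding U_large phi_cyclic).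
Qed.
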